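(* Let $\preceq$ be a partial order on $\overline{\mathbb{R}}^d$ satisfying conditions (I1), (I2), (I3) of the context, and let $\mathcal{V}$ be a family of closed intervals with respect to $\preceq$. Let $\{\mathrm{Med}\,X\}$ be the median set, with respect to $\preceq$, of a random variable $X$ with values in $\mathbb{R}^d$, and let $f:\mathbb{R}^d\to\mathbb{R}$ be a C-function with respect to $\mathcal{V}$. Then for every $M\in\{\mathrm{Med}\,f(X)\}$ there exists an $m\in\{\mathrm{Med}\,X\}$ such that $$f(m)\le M.$$ In particular, if $\{\mathrm{Med}\,X\}$ or $\{\mathrm{Med}\,f(X)\}$ consists of a single point, then $f(m)\le M$ holds for all $m\in\{\mathrm{Med}\,X\}$ and all $M\in\{\mathrm{Med}\,f(X)\}$.
   Context: $\overline{\mathbb{R}}=\mathbb{R}\cup\{-\infty,+\infty\}$. For a partial order $\preceq$ on $\overline{\mathbb{R}}^d$ and $a,b\in\overline{\mathbb{R}}^d$, the interval is $[a,b]=\{x\in\mathbb{R}^d : a\preceq x\preceq b\}$. Conditions: (I1) Every interval $[a,b]$ is topologically closed, and for $a,b\in\mathbb{R}^d$ the interval $[a,b]$ is compact. (I2) For any ball $B\subset\mathbb{R}^d$ there exist $a,b\in\mathbb{R}^d$ such that $B\subset[a,b]$. (I3) For any set $S\subset\overline{\mathbb{R}}^d$ containing at least one point of $\mathbb{R}^d$: if $S$ is bounded from above (with respect to $\preceq$) by a point of $\mathbb{R}^d$, then $\sup S$ exists and lies in $\mathbb{R}^d$; if $S$ is bounded from below by a point of $\mathbb{R}^d$, then $\inf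 S$ exists and lies in $\mathbb{R}^d$. The median set of $X$ with respect to $\preceq$ is $\{\mathrm{Med}\,X\}=\bigcap\{[a,b]: a,b\in\overline{\mathbb{R}}^d,\ \mathrm{Prob}(X\in[a,b])>\frac12\}$. For the real random variable $f(X)$, $\{\mathrm{Med}\,f(X)\}$ is the usual set of medians: all $M\in\mathbb{R}$ with $\mathrm{Prob}(f(X)\le M)\ge\frac12$ and $\mathrm{Prob}(f(X)\ge M)\ge\frac12$. A function $f:\mathbb{R}^d\to\mathbb{R}$ is a C-function with respect to a family $\mathcal{V}$ of closed subsets of $\mathbb{R}^d$ if for every $t\in\mathbb{R}$ the set $f^{-1}((-\infty,t])$ is either empty or belongs to $\mathcal{V}$. *)

(* Defs.v *)
From HB Require Import structures.
From mathcomp Require Import all_boot all_order all_algebra.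
From mathcomp Require Import all_classical all_reals all_analysis.

Set Implicit Arguments.
Unset Strict Implicit.
Unset Printing Implicit Defensive.

Import Order.TTheory GRing.Theory Num.Theory.
Import numFieldNormedType.Exports.

Local Open Scope classical_set_scope.
Local Open Scope ring_scope.

(* R^d is ['rV[R]_d] and [-oo, +oo]^d is ['rV[\bar R]_d]. *)
Definition ext_vec (R : realType) (d : nat) (x : 'rV[R]_d) : 'rV[\bar R]_d :=
  map_mx (@EFin R) x.

Definition is_partial_order (T : Type) (le : rel T) : Prop :=
  [/\ reflexive le, antisymmetric le & transitive le].

(* Least upper bound and greatest lower bound for an arbitrary relation (the
   library's [supremums] and [infimums] require a canonical order on [T]). *)
Definition is_sup (T : Type) (le : rel T) (S : set T) (s : T) : Prop :=
  (forall x, S x -> le x s) /\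
  (forall u, (forall x, S x -> le x u) -> le s u).

Definition is_inf (T : Type) (le : rel T) (S : set T) (s : T) : Prop :=
  (forall x, S x -> le s x) /\
  (forall l, (forall x, S x -> le l x) -> le l s).

(* The endpoints may be infinite, but only the points of R^d are kept. *)
Definition order_itv (R : realType) (d : nat) (le : rel 'rV[\bar R]_d)
    (a b : 'rV[\bar R]_d) : set 'rV[R]_d :=
  [set x | le a (ext_vec x) /\ le (ext_vec x) b].

(* The library's [ball] on ['rV[R]_d] is the one of the max norm. *)
Definition euclidean_ball (R : realType) (d : nat) (c : 'rV[R]_d) (r : R) :
    set 'rV[R]_d :=
  [set x | Num.sqrt (\sum_(i < d) (x 0 i - c 0 i) ^+ 2) < r].

Definition cond_I1 (R : realType) (d : nat) (le : rel 'rV[\bar R]_d) : Prop :=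
  (forall a b : 'rV[\bar R]_d, closed (order_itv le a b)) /\
  (forall a b : 'rV[R]_d, compact (order_itv le (ext_vec a) (ext_vec b))).

Definition cond_I2 (R : realType) (d : nat) (le : rel 'rV[\bar R]_d) : Prop :=
  forall (c : 'rV[R]_d) (r : R), exists a b : 'rV[R]_d,
    euclidean_ball c r `<=` order_itv le (ext_vec a) (ext_vec b).

Definition cond_I3 (R : realType) (d : nat) (le : rel 'rV[\bar R]_d) : Prop :=
  forall S : set 'rV[\bar R]_d,
    (exists x : 'rV[R]_d, S (ext_vec x)) ->
    ((exists u : 'rV[R]_d, forall x, S x -> le x (ext_vec u)) ->
       exists s : 'rV[R]_d, is_sup le S (ext_vec s)) /\
    ((exists l : 'rV[R]_d, forall x, S x -> le (ext_vec l) x) ->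
       exists s : 'rV[R]_d, is_inf le S (ext_vec s)).

(* R^d equipped with its Borel sigma-algebra. *)
Definition borel_vec (R : realType) (d : nat) :=
  g_sigma_algebraType (@open 'rV[R]_d).

Definition median_set (disp : measure_display) (Omega : measurableType disp)
    (R : realType) (P : probability Omega R) (d : nat)
    (le : rel 'rV[\bar R]_d) (X : Omega -> 'rV[R]_d) : set 'rV[R]_d :=
  \bigcap_(ab in [set ab : 'rV[\bar R]_d * 'rV[\bar R]_d |
                   ((2^-1)%:E < P (X @^-1` order_itv le ab.1 ab.2))%E])
    order_itv le ab.1 ab.2.

Definition real_median_set (disp : measure_display)
    (Omega : measurableType disp) (R : realType) (P : probability Omega R)
    (Y : Omega -> R) : set R :=
  [set M | ((2^-1)%:E <= P [set w | (Y w <= M)%R])%E /\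
           ((2^-1)%:E <= P [set w | (Y w >= M)%R])%E].

Definition closed_interval_family (R : realType) (d : nat)
    (le : rel 'rV[\bar R]_d) (V : set (set 'rV[R]_d)) : Prop :=
  forall J, V J ->
    closed J /\ exists a b : 'rV[\bar R]_d, J = order_itv le a b.

Definition C_function (R : realType) (d : nat) (V : set (set 'rV[R]_d))
    (f : 'rV[R]_d -> R) : Prop :=
  forall t : R, [set x | f x <= t] = set0 \/ V [set x | f x <= t].

(* Main.v *)
Require Import Defs.
From HB Require Import structures.
From mathcomp Require Import all_boot all_order all_algebra.
From mathcomp Require Import all_classical all_reals all_analysis.

(** Write J_M for the sublevel set of f at level M.  If M is a median of f(X),
    then J_M carries mass at least 1/2, so it is nonempty and, f being a
    C-function, it is an order interval.  A set of mass at least 1/2 meets every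
    set of mass greater than 1/2, so J_M together with the intervals of mass
    greater than 1/2 is a family of pairwise intersecting intervals.

    Such families have a Helly property ([order_itv_helly]): two intervals
    [a, b] and [a', b'] that meet satisfy a <= b' by transitivity, so every
    lower endpoint lies below every upper endpoint, and the supremum of the
    lower endpoints lies in all the intervals.  For (I3) to yield this supremum
    as a point of R^d, the family must contain one interval with finite
    endpoints; (I2) provides one, since intervals that contain large balls carry
    mass close to 1 ([finite_itv_mass]).  A common point is then a median m of X
    that lies in J_M, that is, f m <= M.

    When the median of X is unique, it is this m.  When f(X) has the single
    median M, no t > M satisfies P(f(X) <= t) <= 1/2, since t
    would be a median too ([real_median_of_le_half]); hence J_t
    is an interval of mass greater than 1/2, every median of X lies in it, and
    t tends to M. *)

Import Order.TTheory GRing.Theory Num.Theory.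
Import numFieldNormedType.Exports.

Local Open Scope classical_set_scope.
Local Open Scope ring_scope.

Lemma order_itv_meet_le (R : realType) (d : nat) (le : rel 'rV[\bar R]_d)
    (a b a' b' : 'rV[\bar R]_d) :
  transitive le -> order_itv le a b `&` order_itv le a' b' !=set0 -> le a b'.
Proof. by move=> tr [x [[ax _] [_ xb']]]; exact: tr ax xb'. Qed.

(** The common point is the supremum of the lower endpoints; the interval with
    finite endpoints makes (I3) applicable, its lower endpoint being a point of
    R^d in the set and its upper endpoint a bound of the set in R^d. *)
Lemma order_itv_helly (R : realType) (d : nat) (le : rel 'rV[\bar R]_d)
    (F : set ('rV[\bar R]_d * 'rV[\bar R]_d)) :
  transitive le -> cond_I3 le ->
  (exists a b : 'rV[R]_d, F (ext_vec a, ext_vec b)) ->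
  (forall p q, F p -> F q ->
     order_itv le p.1 p.2 `&` order_itv le q.1 q.2 !=set0) ->
  \bigcap_(p in F) order_itv le p.1 p.2 !=set0.
Proof.
move=> tr I3 [a0 [b0 F0]] meet.
have le_lower_upper p q : F p -> F q -> le p.1 q.2.
  by move=> Fp Fq; exact: order_itv_meet_le tr (meet _ _ Fp Fq).
have [] := I3 [set p.1 | p in F].
  by exists a0; exists (ext_vec a0, ext_vec b0).
case=> [|s [s_ub s_least] _].
  by exists b0 => _ [p Fp <-]; exact: (le_lower_upper p (ext_vec a0, ext_vec b0)).
exists s => q Fq; split; first by apply: s_ub; exists q.
by apply: s_least => _ [p Fp <-]; exact: le_lower_upper.
Qed.

Lemma measurable_preimage_closed (disp : measure_display)
    (Omega : measurableType disp) (R : realType) (d : nat)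
    (X : {mfun Omega >-> borel_vec R d}) (A : set 'rV[R]_d) :
  closed A -> measurable (X @^-1` A).
Proof.
move=> cA; apply: measurable_funPTI.
rewrite -[A]setCK; apply: measurableC; apply: sub_sigma_algebra.
exact: closed_openC.
Qed.

Lemma half_mass_meet (disp : measure_display) (Omega : measurableType disp)
    (R : realType) (P : probability Omega R) (A B : set Omega) :
  measurable A -> measurable B ->
  ((2^-1)%:E <= P A)%E -> ((2^-1)%:E < P B)%E -> A `&` B !=set0.
Proof.
move=> mA mB hA hB; apply/set0P/eqP => AB0.
have := probability_le1 P (measurableU _ _ mA mB).
rewrite measureU // leNgt => /negP; apply.
suff : ((2^-1)%:E + (2^-1)%:E < P A + P B)%E.
  by rewrite -EFinD -[2^-1]div1r -splitr.
by apply: lee_ltD.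
Qed.

(** The intervals given by (I2) for the balls of radius n need not increase
    with n; the intersections of their tails do, and still contain the balls,
    so that they exhaust R^d. *)
Lemma finite_itv_mass (R : realType) (d : nat) (le : rel 'rV[\bar R]_d)
    (disp : measure_display) (Omega : measurableType disp)
    (P : probability Omega R) (X : {RV P >-> borel_vec R d}) (p : R) :
  cond_I1 le -> cond_I2 le -> p < 1 ->
  exists a b : 'rV[R]_d,
    (p%:E < P (X @^-1` order_itv le (ext_vec a) (ext_vec b)))%E.
Proof.
move=> [itv_closed _] I2 p1.
have /choice[ab ball_ab] (n : nat) : exists ab : 'rV[R]_d * 'rV[R]_d,
    euclidean_ball 0 n%:R `<=` order_itv le (ext_vec ab.1) (ext_vec ab.2).
  by have [a [b h]] := I2 0 n%:R; exists (a, b).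
pose K n := X @^-1` order_itv le (ext_vec (ab n).1) (ext_vec (ab n).2).
have mK n : measurable (K n) by exact: measurable_preimage_closed.
pose L n := \bigcap_(k in [set k | (n <= k)%N]) K k.
have mL n : measurable (L n).
  by apply: bigcap_measurable => //; exists n => /=.
have LT : \bigcup_n L n = setT.
  apply/seteqP; split=> // w _.
  set r := Num.sqrt (\sum_(i < d) (X w 0 i - (0 : 'rV[R]_d) 0 i) ^+ 2).
  exists (Num.trunc r).+1 => // k /= rk; apply: (ball_ab k).
  by apply: lt_le_trans (truncnS_gt r) _; rewrite ler_nat.
have L_nondecr : {homo L : n m / (n <= m)%N >-> (n <= m)%O}.
  by move=> n m nm; apply/subsetPset => w Lw k /= mk; apply: Lw; exact: leq_trans mk.
have mLT : measurable (\bigcup_n L n) by rewrite LT.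
have PL : P (L n) @[n --> \oo] --> 1%E.
  by rewrite -(@probability_setT _ _ _ P) -LT; exact: nondecreasing_cvg_mu.
suff [n Ln] : exists n, (p%:E < P (L n))%E.
  exists (ab n).1, (ab n).2; apply: lt_le_trans Ln _.
  by apply: le_measure; rewrite ?inE //; [exact: mK|move=> w; apply=> /=].
apply: contrapT => /forallNP small.
suff : (1 <= p%:E)%E by rewrite lee_fin leNgt p1.
rewrite -(cvg_lim _ PL) //; apply: lime_le; first by apply: cvgP PL.
by apply: nearW => n /=; rewrite leNgt; apply/negP.
Qed.

(** For a C-function f only the events f(X) <= t are given, as preimages of
    closed sets; their complements, the preimages of open upper rays, generate
    the others, in particular the events f(X) >= t of the median condition. *)
Lemma measurable_fun_sublevel (disp : measure_display)
    (Omega : measurableType disp) (R : realType) (Y : Omega -> R) :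
  (forall t, measurable [set w | Y w <= t]) -> measurable_fun setT Y.
Proof.
move=> mY; apply: (measurability _ (measurable_realfun.RGenOInfty.measurableE R)).
move=> _ [_ [t ->] <-]; rewrite setTI.
suff -> : Y @^-1` `]t, +oo[ = ~` [set w | Y w <= t] by exact: measurableC.
by apply/seteqP; split => w /=; rewrite in_itv /= andbT ltNge => /negP.
Qed.

(** The distribution function of Y is constant, equal to 1/2, from M to t;
    moreover P(Y >= t) >= P(Y > t) = 1 - P(Y <= t) >= 1/2. *)
Lemma real_median_of_le_half (disp : measure_display)
    (Omega : measurableType disp) (R : realType) (P : probability Omega R)
    (Y : Omega -> R) (M t : R) :
  measurable_fun setT Y -> real_median_set P Y M -> M <= t ->
  (P [set w | (Y w <= t)%R] <= (2^-1)%:E)%E -> real_median_set P Y t.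
Proof.
move=> mY [hM _] Mt ht.
have mle u : measurable [set w | Y w <= u].
  by rewrite -[X in measurable X]setTI; apply: measurable_fun_le.
have mge : measurable [set w | t <= Y w].
  by rewrite -[X in measurable X]setTI; apply: measurable_fun_le.
split.
  apply: le_trans hM _; apply: le_measure; rewrite ?inE //.
  by move=> w /= /le_trans; exact.
apply: (@le_trans _ _ (P (~` [set w | Y w <= t]))); last first.
  apply: le_measure; rewrite ?inE //; first exact: measurableC.
  by move=> w /= /negP; rewrite -ltNge => /ltW.
rewrite probability_setC //.
have -> : (2^-1)%:E = (1 - (2^-1)%:E :> \bar R)%E.
  by rewrite -EFinB; congr EFin; rewrite {2}[1]splitr div1r addrK.
exact: leeB.
Qed.

Theorem theorem7p1 (R : realType) (d : nat) (le : rel 'rV[\bar R]_d)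
    (le_order : is_partial_order le)
    (I1 : cond_I1 le) (I2 : cond_I2 le) (I3 : cond_I3 le)
    (V : set (set 'rV[R]_d)) (V_itv : closed_interval_family le V)
    (disp : measure_display) (Omega : measurableType disp)
    (P : probability Omega R) (X : {RV P >-> borel_vec R d})
    (f : 'rV[R]_d -> R) (f_C : C_function V f) :
  (forall M, real_median_set P (fun w => f (X w)) M ->
     exists m, median_set P le X m /\ f m <= M) /\
  ((exists m0, median_set P le X = [set m0]) \/
   (exists M0, real_median_set P (fun w => f (X w)) = [set M0]) ->
   forall m M, median_set P le X m ->
     real_median_set P (fun w => f (X w)) M -> f m <= M).
Proof.
have [_ _ tr] := le_order.
have half_lt1 : 2^-1 < 1 :> R by rewrite invf_lt1 // ltr1n.
have m_itv (a b : 'rV[\bar R]_d) : measurable (X @^-1` order_itv le a b).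
  exact/measurable_preimage_closed/I1.1.
have sublevel_itv t : (0 < P [set w | (f (X w) <= t)%R])%E ->
    exists a b : 'rV[\bar R]_d, [set x | f x <= t] = order_itv le a b.
  move=> Pt; case: (f_C t) => [J0|/V_itv[]//].
  suff W0 : [set w | f (X w) <= t] = set0 by rewrite W0 measure0 ltxx in Pt.
  by rewrite -subset0 => w /= ft; have : [set x | f x <= t] (X w) by []; rewrite J0.
have mfX : measurable_fun setT (fun w => f (X w)).
  apply: measurable_fun_sublevel => t.
  apply: (measurable_preimage_closed _ _ _ _ X [set x | f x <= t]).
  by case: (f_C t) => [->|/V_itv[]//]; exact: closed0.
have exists_med M : real_median_set P (fun w => f (X w)) M ->
    exists m, median_set P le X m /\ f m <= M.
  move=> [hM _].
  have [a [b Jab]] : exists a b, [set x | f x <= M] = order_itv le a b.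
    by apply: sublevel_itv; apply: lt_le_trans hM; rewrite lte_fin invr_gt0.
  pose big := [set p : 'rV[\bar R]_d * 'rV[\bar R]_d |
    ((2^-1)%:E < P (X @^-1` order_itv le p.1 p.2))%E].
  have half_ab : ((2^-1)%:E <= P (X @^-1` order_itv le a b))%E by rewrite -Jab.
  have meet p q : ((2^-1)%:E <= P (X @^-1` order_itv le p.1 p.2))%E -> big q ->
      order_itv le p.1 p.2 `&` order_itv le q.1 q.2 !=set0.
    move=> hp hq.
    have [w ww] := half_mass_meet _ _ _ _ _ _ (m_itv _ _) (m_itv _ _) hp hq.
    by exists (X w).
  have [m m_all] : \bigcap_(p in big `|` [set (a, b)]) order_itv le p.1 p.2 !=set0.
    apply: order_itv_helly => //.
      have [a0 [b0 h0]] := finite_itv_mass _ _ _ _ _ _ X _ I1 I2 half_lt1.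
      by exists a0, b0; left.
    move=> p q [bp|->] [bq|->].
    - by apply: meet => //; exact: ltW.
    - by rewrite setIC; exact: meet.
    - exact: meet.
    (* The sublevel set must be shown to meet itself, that is, to be nonempty:
       its mass is only known to be at least 1/2. *)
    - rewrite setIid; have : [set w | f (X w) <= M] !=set0.
        apply/set0P/eqP => W0; move: hM; rewrite W0 measure0 lee_fin.
        by rewrite leNgt invr_gt0 ltr0n.
      by move=> [w fw]; exists (X w); rewrite /= -Jab.
  exists m; split; first by move=> p bp; apply: m_all; left.
  by have : order_itv le a b m; [apply: (m_all (a, b)); right|rewrite -Jab].
split=> // -[[m0 med0]|[M0 med0]] m M mm hM.
  have [m1 [mm1 fm1]] := exists_med M hM.
  by move: mm mm1; rewrite med0 => -> <-.
apply/ler_addgt0Pr => e e0; set t := M + e.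
have [ht|ht] := leP (P [set w | f (X w) <= t]) (2^-1)%:E.
  have Mt : M <= t by rewrite lerDl ltW.
  have := real_median_of_le_half _ _ _ _ _ _ _ mfX hM Mt ht.
  move: hM; rewrite med0 => /= MM0 tM0.
  by have : M < t by [rewrite ltrDl]; rewrite tM0 MM0 ltxx.
have [a [b Jab]] : exists a b, [set x | f x <= t] = order_itv le a b.
  by apply: sublevel_itv; apply: lt_trans ht; rewrite lte_fin invr_gt0.
suff : order_itv le a b m by rewrite -Jab.
by apply: (mm (a, b)) => /=; rewrite -Jab.
Qed.
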